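(* Let $\mathbb F$ be a division ring, $B\in\mathbb F^{k\times k}$ and $\mathbf u\in\mathbb F^{1\times k}$. The output pair $(\mathbf u,B)$ is observable if and only if for every $\mathbf d\in\mathbb F^{1\times k}$ there is a polynomial $f\in\mathbb F[z]$ such that $$(f\mathbf u)^{\mathfrak e_r}(B)=\mathbf d.$$ In this case, for each $\mathbf d\in\mathbb F^{1\times k}$, all polynomials $f\in\mathbb F[z]$ satisfying this condition are given by the formula $$f=f_r+h\,\mathfrak P_{\mathbf u,B},\qquad f_r(z)=\mathbf d\,\mathfrak O_{\mathbf u,B}^{-1}\mathfrak A_k(z)^\top,\qquad h\in\mathbb F[z],$$ where $h$ is a free parameter and $f_r$ is the low-degree solution (the solution of degree less than $k$).
   Context: $\mathbb F[z]$ is the ring of polynomials over $\mathbb F$ in a formal variable $z$ commuting with the coefficients. For $f(z)=\sum_jf_jz^j$, $(f\mathbf u)^{\mathfrak e_r}(B)=\sum_jf_j\mathbf uB^j$. $\mathfrak P_{\mathbf u,B}$ is the monic generator of the left ideal $\{p\in\mathbb F[z]:(p\mathbf u)^{\mathfrak e_r}(B)=0\}$. $\mathfrak A_k(z)=[1\ z\ \cdots\ z^{k-1}]$, $\mathfrak O_{\mathbf u,B}$ is the $k\times k$ matrix with rows $\mathbf u,\mathbf uB,\dots,\mathbf uB^{k-1}$, and $(\mathbf u,B)$ is observable if $\mathfrak O_{\mathbf u,B}$ is invertible. *)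

(* Defs.v *)
From HB Require Import structures.
From mathcomp Require Import all_boot all_order all_algebra.
From mathcomp Require Import boolp classical_sets.

Set Implicit Arguments.
Unset Strict Implicit.
Unset Printing Implicit Defensive.

Import GRing.Theory.
Local Open Scope ring_scope.

(* A [unitRingType] is nontrivial but need not be commutative. *)
Definition division_ring (F : unitRingType) : Prop :=
  forall x : F, x != 0 -> x \is a GRing.unit.

(* [unitmx] and [invmx] require a commutative base ring, so invertibility over
   a division ring is stated with a two-sided inverse. *)
Definition is_inverse_mx (F : unitRingType) (k : nat) (A C : 'M[F]_k) : Prop :=
  A *m C = 1%:M /\ C *m A = 1%:M.

Definition invertible_mx (F : unitRingType) (k : nat) (A : 'M[F]_k) : Prop :=
  exists C : 'M[F]_k, is_inverse_mx A C.

(* The inverse of [A] (necessarily unique); 0 when [A] is not invertible. *)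
Definition inverse_mx (F : unitRingType) (k : nat) (A : 'M[F]_k) : 'M[F]_k :=
  xget 0 [set C : 'M[F]_k | is_inverse_mx A C].

(* (f u)^{e_r}(B): the coefficients f_j act by left multiplication. *)
Definition right_eval (F : unitRingType) (k : nat) (u : 'rV[F]_k) (B : 'M[F]_k)
    (f : {poly F}) : 'rV[F]_k :=
  \sum_(j < size f) f`_j *: (u *m B ^+ j).

(* [p] is monic and generates [I] as a left ideal, i.e. I = F[z] p. *)
Definition monic_left_generator (F : unitRingType) (I : set {poly F})
    (p : {poly F}) : Prop :=
  p \is monic /\ I = [set h * p | h in setT]%classic.

(* The monic generator P_{u,B} of the left ideal {p | (p u)^{e_r}(B) = 0}.
   Over a division ring this ideal is nonzero (the k + 1 rows u, u B, ...,
   u B^k are left dependent), so the generator exists and is unique; the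
   default value 0 of [xget] is then never taken. *)
Definition min_poly (F : unitRingType) (k : nat) (u : 'rV[F]_k) (B : 'M[F]_k) :
    {poly F} :=
  xget 0 [set P : {poly F} |
    monic_left_generator [set p : {poly F} | right_eval u B p = 0] P].

Definition power_row (F : unitRingType) (k : nat) : 'rV[{poly F}]_k :=
  \row_(j < k) 'X^j.

Definition obs_mx (F : unitRingType) (k : nat) (u : 'rV[F]_k) (B : 'M[F]_k) :
    'M[F]_k :=
  \matrix_(i < k) (u *m B ^+ i).

Definition observable (F : unitRingType) (k : nat) (u : 'rV[F]_k)
    (B : 'M[F]_k) : Prop :=
  invertible_mx (obs_mx u B).

(* f_r(z) = d O_{u,B}^{-1} A_k(z)^T, the entry of a 1 x 1 matrix over F[z]. *)
Definition low_degree_sol (F : unitRingType) (k : nat) (u : 'rV[F]_k)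
    (B : 'M[F]_k) (d : 'rV[F]_k) : {poly F} :=
  (map_mx polyC (d *m inverse_mx (obs_mx u B)) *m (power_row F k)^T) 0 0.

(* Main.v *)
Require Import Defs.
From HB Require Import structures.
From mathcomp Require Import all_boot all_order all_algebra.
From mathcomp Require Import boolp classical_sets.

Set Implicit Arguments.
Unset Strict Implicit.
Unset Printing Implicit Defensive.

Import GRing.Theory.
Local Open Scope ring_scope.

(** The map [f |-> (f u)^{e_r}(B)] is left linear and intertwines left
    multiplication by [z] with right multiplication by [B], so its kernel is a
    left ideal; on polynomials of degree less than [k] it is the map
    [c |-> c O_{u,B}]. The [k + 1] rows [u, u B, ..., u B^k] are left dependent,
    so the kernel contains a monic polynomial of degree at most [k]. Right
    division by it shows that every value is already attained in degree less
    than [k]: surjectivity therefore gives a left inverse of [O_{u,B}], which is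
    two-sided over a division ring. If [O_{u,B}] is invertible, no nonzero
    polynomial of degree less than [k] is in the kernel, so the same division
    shows that the monic polynomial above generates the kernel. *)

(** Gaussian elimination by induction on the number of columns: a zero first column is dropped,
    otherwise a nonzero entry of it serves as pivot. *)
Lemma left_kernel_exists (F : unitRingType) (hF : division_ring F) (n m : nat)
    (A : 'M[F]_(m, n)) :
  (n < m)%N -> exists2 v : 'rV[F]_m, v != 0 & v *m A = 0.
Proof.
elim: n m A => [|n IHn] m A lt_nm.
  exists (const_mx 1); last by apply/rowP; case.
  case: m A lt_nm => // m A _; apply/eqP => /rowP /(_ ord0).
  by rewrite !mxE; apply/eqP; exact: oner_neq0.
rewrite -[n.+1]add1n in A lt_nm *.
rewrite -[A]hsubmxK; set c := lsubmx A; set A' := rsubmx A.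
have [c0|] := eqVneq c 0.
  have [v v0 vA] := IHn m A' (ltnW lt_nm).
  by exists v => //; rewrite mul_mx_row vA c0 mulmx0 row_mx0.
case/cV0Pn => i ci0.
(* Left multiplication by [N] subtracts from each row the left multiple of row [i] that clears its
   entry in [c], then deletes row [i]. *)
pose N : 'M[F]_(m.-1, m) :=
  row' i (1%:M - c *m (c i 0)^-1%:M *m delta_mx 0 i).
have Nc : N *m c = 0.
  rewrite /N row'Esub mul_rowsub_mx mulmxBl mul1mx -!mulmxA -rowE.
  suff -> : (c i 0)^-1%:M *m row i c = 1%:M by rewrite mulmx1 subrr linear0.
  rewrite [row i c]mx11_scalar -scalar_mxM [row i c 0 0]mxE mulVr //.
  exact: hF.
(* [N] contains an identity block, so [w *m N] is nonzero whenever [w] is. *)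
have N1 : col' i N = 1%:M.
  apply/matrixP => x y; rewrite !mxE big_ord1 !mxE (inj_eq lift_inj).
  by rewrite [lift i y == i]eq_sym (negPf (neq_lift i y)) andbF mulr0 subr0.
have lt_nm' : (n < m.-1)%N by case: (m) lt_nm.
have [w w0 wNA] := IHn _ (N *m A') lt_nm'.
exists (w *m N); last by rewrite mul_mx_row -!mulmxA Nc wNA mulmx0 row_mx0.
apply: contraNneq w0 => wN0.
by rewrite -[w]mulmx1 -N1 col'Esub mulmx_colsub wN0 linear0.
Qed.

(** Since [C *m A = 1%:M], the rows of [C] are left independent; by dimension they span, so [C] also
    has a left inverse, which must be [A]. *)
Lemma left_inverse_mx_comm (F : unitRingType) (hF : division_ring F) (k : nat)
    (A C : 'M[F]_k) :
  C *m A = 1%:M -> A *m C = 1%:M.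
Proof.
move=> CA1.
have solve (d : 'rV[F]_k) : exists v : 'rV[F]_k, v *m C = d.
  have [] := left_kernel_exists hF (col_mx d C) (leqnn _).
  move=> w w0; rewrite -[w]hsubmxK mul_row_col.
  set a := lsubmx w; set v := rsubmx w => avC0.
  have aE : a *m d = a 0 0 *: d by rewrite {1}[a]mx11_scalar mul_scalar_mx.
  (* In a dependency between [d] and the rows of [C], the coefficient of [d] cannot vanish, so it
     can be divided out on the left. *)
  have [a0|/hF aU] := eqVneq (a 0 0) 0.
    have vC0 : v *m C = 0 by move: avC0; rewrite aE a0 scale0r add0r.
    have v0 : v = 0 by rewrite -[v]mulmx1 -CA1 mulmxA vC0 mul0mx.
    case/negP: w0; rewrite -[w]hsubmxK -/a -/v v0 [a]mx11_scalar a0.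
    by rewrite raddf0 row_mx0.
  exists (- (a 0 0)^-1 *: v).
  move: avC0 => /eqP; rewrite aE addr_eq0 => /eqP adE.
  by rewrite scaleNr mulNmx -scalemxAl -scalerN -adE scalerA mulVr ?scale1r.
have [v vC] := choice (fun i => solve (row i 1%:M)).
pose D : 'M[F]_k := \matrix_i v i.
have DC1 : D *m C = 1%:M.
  by apply/row_matrixP => i; rewrite row_mul rowK vC.
by rewrite -[A]mul1mx -DC1 -(mulmxA D) CA1 mulmx1.
Qed.

Section RightEval.

Variables (F : unitRingType) (k : nat) (u : 'rV[F]_k) (B : 'M[F]_k).

Lemma right_eval_bound (n : nat) (f : {poly F}) : (size f <= n)%N ->
  right_eval u B f = \sum_(j < n) f`_j *: (u *m B ^+ j).
Proof.
move=> le_fn; rewrite /right_eval.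
rewrite (big_ord_widen n (fun j => f`_j *: (u *m B ^+ j)) le_fn) big_mkcond /=.
apply: eq_bigr => j _; case: ltnP => // le_fj.
by rewrite nth_default ?scale0r.
Qed.

Lemma right_evalD (f g : {poly F}) :
  right_eval u B (f + g) = right_eval u B f + right_eval u B g.
Proof.
rewrite (right_eval_bound (size_polyD f g)).
rewrite (right_eval_bound (leq_maxl (size f) (size g))).
rewrite (right_eval_bound (leq_maxr (size f) (size g))) -big_split /=.
by apply: eq_bigr => j _; rewrite coefD scalerDl.
Qed.

Lemma right_evalZ (a : F) (f : {poly F}) :
  right_eval u B (a *: f) = a *: right_eval u B f.
Proof.
rewrite (right_eval_bound (size_scale_leq a f)) scaler_sumr.
by apply: eq_bigr => j _; rewrite coefZ scalerA.
Qed.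

Lemma right_evalB (f g : {poly F}) :
  right_eval u B (f - g) = right_eval u B f - right_eval u B g.
Proof. by rewrite -scaleN1r right_evalD right_evalZ scaleN1r. Qed.

Lemma right_evalXM (f : {poly F}) :
  right_eval u B ('X * f) = right_eval u B f *m B.
Proof.
have le_Xf : (size ('X * f)%R <= (size f).+1)%N.
  by rewrite (leq_trans (size_polyMleq _ _)) // size_polyX.
rewrite (right_eval_bound le_Xf) big_ord_recl coefXM scale0r add0r mulmx_suml.
by apply: eq_bigr => j _; rewrite coefXM /= exprSr -scalemxAl mulmxA.
Qed.

(** Horner induction on [h], with [p] generalized: the inductive step applies the hypothesis to
    ['X * p], which is again in the kernel. *)
Lemma right_eval_mull0 (h p : {poly F}) :
  right_eval u B p = 0 -> right_eval u B (h * p) = 0.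
Proof.
elim/poly_ind: h p => [|h c IHh] p p0.
  by rewrite mul0r /right_eval size_poly0 big_ord0.
rewrite mulrDl -mulrA mul_polyC right_evalD right_evalZ p0 scaler0 addr0.
by rewrite IHh // right_evalXM p0 mul0mx.
Qed.

Lemma right_eval_rVpoly (n : nat) (c : 'rV[F]_n) :
  right_eval u B (rVpoly c) = c *m \matrix_(i < n) (u *m B ^+ i).
Proof.
rewrite (right_eval_bound (size_poly _ _)) mulmx_sum_row.
by apply: eq_bigr => j _; rewrite coef_rVpoly_ord rowK.
Qed.

Lemma monic_annihilator_exists : division_ring F ->
  exists p : {poly F},
    [/\ p \is monic, (size p <= k.+1)%N & right_eval u B p = 0].
Proof.
move=> hF.
have [c c0 cB0] :=
  left_kernel_exists hF (\matrix_(i < k.+1) (u *m B ^+ i)) (leqnn _).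
pose p := rVpoly c.
have lpU : lead_coef p \is a GRing.unit.
  apply: hF; rewrite lead_coef_eq0; apply: contraNneq c0 => p0.
  by rewrite -[c]rVpolyK -/p p0 linear0.
exists ((lead_coef p)^-1 *: p); split.
(* The scaling factor is a unit, hence left regular, so the leading coefficient is scaled without
   cancellation. *)
- rewrite monicE lead_coef_lreg ?mulVr //.
  by apply: mulrI; rewrite unitrV.
- exact: leq_trans (size_scale_leq _ _) (size_poly _ _).
- by rewrite right_evalZ right_eval_rVpoly cB0 scaler0.
Qed.

Lemma low_degree_solE (d : 'rV[F]_k) :
  low_degree_sol u B d = rVpoly (d *m inverse_mx (obs_mx u B)).
Proof.
rewrite /low_degree_sol mxE /rVpoly poly_def.
by apply: eq_bigr => i _; rewrite valK !mxE mul_polyC.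
Qed.

Section Observable.

Hypothesis obs : observable u B.

(** Observability provides an inverse, so [xget] does not return its default. *)
Let inv : is_inverse_mx (obs_mx u B) (inverse_mx (obs_mx u B)).
Proof. exact: xgetPex obs. Qed.

Lemma right_eval_low_degree_sol (d : 'rV[F]_k) :
  right_eval u B (low_degree_sol u B d) = d.
Proof.
by rewrite low_degree_solE right_eval_rVpoly -mulmxA inv.2 mulmx1.
Qed.

Lemma right_eval_small_eq0 (f : {poly F}) :
  (size f <= k)%N -> right_eval u B f = 0 -> f = 0.
Proof.
move=> le_fk; rewrite -(poly_rV_K le_fk) right_eval_rVpoly => fO0.
rewrite -[poly_rV f]mulmx1 -inv.1 mulmxA.
by rewrite /obs_mx fO0 mul0mx linear0.
Qed.

Lemma min_polyP : division_ring F ->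
  monic_left_generator [set p : {poly F} | right_eval u B p = 0]%classic
    (min_poly u B).
Proof.
move=> hF.
apply: (xgetPex 0 (P := [set P | monic_left_generator _ P]%classic)).
have [p [p_monic le_pk p0]] := monic_annihilator_exists hF.
exists p; split=> //; apply/seteqP; split=> [f /= f0|_ [h _ <-] /=]; last first.
  exact: right_eval_mull0.
have fE := Pdiv.RingMonic.rdivp_eq p_monic f.
exists (Pdiv.Ring.rdivp f p) => //; rewrite {2}fE.
(* The remainder lies in the kernel and has size less than [size p], hence at most [k]. *)
suff -> : Pdiv.Ring.rmodp f p = 0 by rewrite addr0.
apply: right_eval_small_eq0.
  rewrite -ltnS (leq_trans _ le_pk) // Pdiv.Ring.ltn_rmodpN0 //.
  exact: monic_neq0.
by move: f0; rewrite {1}fE right_evalD right_eval_mull0 // add0r.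
Qed.

End Observable.

Lemma observable_of_surjective : division_ring F ->
  (forall d : 'rV[F]_k, exists f : {poly F}, right_eval u B f = d) ->
  observable u B.
Proof.
move=> hF surj.
have [p [p_monic le_pk p0]] := monic_annihilator_exists hF.
have small (d : 'rV[F]_k) : exists c : 'rV[F]_k, c *m obs_mx u B = d.
  have [f <-] := surj d.
  have fE := Pdiv.RingMonic.rdivp_eq p_monic f.
  have le_rk : (size (Pdiv.Ring.rmodp f p) <= k)%N.
    rewrite -ltnS (leq_trans _ le_pk) // Pdiv.Ring.ltn_rmodpN0 //.
    exact: monic_neq0.
  exists (poly_rV (Pdiv.Ring.rmodp f p)).
  rewrite -right_eval_rVpoly poly_rV_K // {2}fE right_evalD.
  by rewrite right_eval_mull0 // add0r.
have [c cO] := choice (fun i => small (row i 1%:M)).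
have CO1 : (\matrix_i c i) *m obs_mx u B = 1%:M.
  by apply/row_matrixP => i; rewrite row_mul rowK cO.
by exists (\matrix_i c i); split=> //; apply: left_inverse_mx_comm.
Qed.

End RightEval.

Theorem theorem5p2 (F : unitRingType) (hF : division_ring F) (k : nat)
    (B : 'M[F]_k) (u : 'rV[F]_k) :
  (observable u B <->
     forall d : 'rV[F]_k, exists f : {poly F}, right_eval u B f = d)
  /\
  (observable u B ->
     forall d : 'rV[F]_k,
       (forall f : {poly F},
          right_eval u B f = d <->
          exists h : {poly F}, f = low_degree_sol u B d + h * min_poly u B)
       /\
       (forall f : {poly F},
          (right_eval u B f = d /\ (size f <= k)%N) <->
          f = low_degree_sol u B d)).
Proof.
split; first split=> [obs d|]; last first.
- move=> obs d; have evr := right_eval_low_degree_sol obs d.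
  split=> f.
    have [_ /seteqP [kerP genP]] := min_polyP obs hF.
    split=> [fd|[h ->]].
      have [|h _ hE] := kerP (f - low_degree_sol u B d).
        by rewrite /= right_evalB fd evr subrr.
      by exists h; rewrite hE addrC subrK.
    by rewrite right_evalD evr (genP (h * min_poly u B)) ?addr0 //; exists h.
  have le_rk : (size (low_degree_sol u B d) <= k)%N.
    by rewrite low_degree_solE size_poly.
  split=> [[fd le_fk]|-> //].
  (* Two solutions of degree less than [k] differ by a kernel element of size at most [k], which is
     zero. *)
  apply/eqP; rewrite -subr_eq0; apply/eqP/(right_eval_small_eq0 obs).
    rewrite (leq_trans (size_polyD _ _)) // size_polyN.
    by rewrite geq_max le_fk.
  by rewrite right_evalB fd evr subrr.
- exact: observable_of_surjective.
- by exists (low_degree_sol u B d); apply: right_eval_low_degree_sol.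
Qed.
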